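(* Let $A$ and $B$ be C$^*$-algebras with $A$ unital, and let $T:A\to B$ be a continuous linear map. Suppose $T$ is a triple homomorphism at the unit of $A$. Then $T$ is a triple homomorphism. Furthermore, $T(1)$ is a partial isometry, and $T$ takes values in $B_2(T(1))$ and $T:A\to B_2(T(1))$ is a Jordan $^*$-homomorphism.
   Context: For $a,b,c$ in a C$^*$-algebra, $\{a,b,c\}=\frac12(ab^*c+cb^*a)$. A linear map $T:A\to B$ is a triple homomorphism at $z\in A$ if $\{T(a),T(b),T(c)\}=T(z)$ for all $a,b,c\in A$ with $\{a,b,c\}=z$. It is a triple homomorphism if $T\{a,b,c\}=\{T(a),T(b),T(c)\}$ for all $a,b,c\in A$. An element $e\in B$ is a partial isometry if $ee^*e=e$; for such $e$, $B_2(e)=ee^*Be^*e$, which is a JB$^*$-algebra with Jordan product $x\circ_e y=\{x,e,y\}=\frac12(xe^*y+ye^*x)$ and involution $x^{\sharp_e}=\{e,x,e\}=ex^*e$. $A$ carries the Jordan product $a\circ b=\frac12(ab+ba)$ and its usual involution. A Jordan $^*$-homomorphism is a linear map preserving Jordan products and involutions; here this means $T(a\circ b)=T(a)\circ_{T(1)}T(b)$ and $T(a^* )=T(a)^{\sharp_{T(1)}}$ for all $a,b\in A$. *)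

(* Defs.v *)
From HB Require Import structures.
From mathcomp Require Import all_boot all_order all_algebra.
From mathcomp Require Import all_classical all_reals all_analysis.
From mathcomp.real_closed Require Export complex.

Set Implicit Arguments.
Unset Strict Implicit.
Unset Printing Implicit Defensive.

Import Order.TTheory GRing.Theory Num.Theory.
Import numFieldNormedType.Exports.

Local Open Scope classical_set_scope.
Local Open Scope ring_scope.

(* The ring structures of the library are unital, so the product of a complex
   C*-algebra, which need not have a unit, is given by its own operation.
   Norms are elements of [R[i]] that are real and nonnegative. *)
HB.mixin Record isCStarAlgebra (R : realType) (A : Type)
    of CompleteNormedModule R[i] A := {
  cmul : A -> A -> A;
  cstar : A -> A;
  cmulA : associative cmul;
  cmulDl : left_distributive cmul +%R;
  cmulDr : right_distributive cmul +%R;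
  cmulZl : forall (k : R[i]) (a b : A), cmul (k *: a) b = k *: cmul a b;
  cmulZr : forall (k : R[i]) (a b : A), cmul a (k *: b) = k *: cmul a b;
  cnormM : forall a b : A, `|cmul a b| <= `|a| * `|b|;
  cstarK : involutive cstar;
  cstarD : {morph cstar : a b / a + b};
  cstarZ : forall (k : R[i]) (a : A), cstar (k *: a) = Num.conj k *: cstar a;
  cstarM : forall a b : A, cstar (cmul a b) = cmul (cstar b) (cstar a);
  cnorm_star : forall a : A, `|cmul (cstar a) a| = `|a| ^+ 2
}.

#[short(type="cstarAlgType")]
HB.structure Definition CStarAlgebra (R : realType) :=
  {A of CompleteNormedModule R[i] A & isCStarAlgebra R A}.

Arguments cmul {R A} : rename.
Arguments cstar {R A} : rename.

Declare Scope cstar_scope.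
Delimit Scope cstar_scope with cstar.
Notation "a ** b" := (cmul a b) (at level 40, left associativity) : cstar_scope.
Notation "a ^☆" := (cstar a) (at level 2, format "a ^☆") : cstar_scope.
Open Scope cstar_scope.

Section CStarDefs.
Context {R : realType}.
Implicit Types A B : cstarAlgType R.

(* The zero algebra is allowed: nothing requires [u] to be nonzero. *)
Definition is_unit {A} (u : A) : Prop :=
  left_id u cmul /\ right_id u cmul.

Definition tprod {A} (a b c : A) : A :=
  2%:R^-1 *: (a ** b^☆ ** c + c ** b^☆ ** a).

Definition jprod {A} (a b : A) : A := 2%:R^-1 *: (a ** b + b ** a).

Definition triple_hom_at {A B} (T : A -> B) (z : A) : Prop :=
  forall a b c : A, tprod a b c = z -> tprod (T a) (T b) (T c) = T z.

Definition triple_hom {A B} (T : A -> B) : Prop :=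
  forall a b c : A, T (tprod a b c) = tprod (T a) (T b) (T c).

Definition partial_isometry {A} (e : A) : Prop := e ** e^☆ ** e = e.

Definition peirce2 {A} (e : A) : set A :=
  range (fun x : A => e ** e^☆ ** x ** e^☆ ** e).

Definition peirce2_jprod {A} (e x y : A) : A := tprod x e y.

Definition peirce2_star {A} (e x : A) : A := tprod e x e.

(* Linearity and [range T `<=` peirce2 e] are separate requirements. *)
Definition jordan_star_hom_peirce2 {A B} (e : B) (T : A -> B) : Prop :=
  (forall a b : A, T (jprod a b) = peirce2_jprod e (T a) (T b)) /\
  (forall a : A, T (a^☆) = peirce2_star e (T a)).

End CStarDefs.

(* Main.v *)
Require Import Defs.
From mathcomp Require Import all_boot all_order all_algebra.
From mathcomp Require Import all_classical all_reals all_analysis.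
Import numFieldNormedType.Exports.
Local Open Scope classical_set_scope.
Local Open Scope ring_scope.
Import Order.TTheory GRing.Theory Num.Theory.

(** The reason behind the theorem is that {a, b, c} = 1 has many solutions,
    namely the triples that an invertible element w produces from y = w^-1:
      {1, w^☆, y} = 1,   {w, 1, y} = 1,   {y, (w w)^☆, y} = 1.
    With w = 1 - t x and t near 0, the element y is the resolvent at x, which
    tends to 1, and y = 1 + t x y holds exactly. The hypothesis on T turns each
    solution into an equation in B; once its constant terms are cancelled it
    can be divided by t, and letting t tend to 0 extracts information about x.

    Write e = T 1, p = e e^☆, q = e^☆ e. Since {1, 1, 1} = 1, e is a partial
    isometry. The three families yield respectively:

    - {e, e, T x} = {e, T (x^☆), e} ([T1_star_transfer]). The right-hand side
      lies in the Peirce 2-space of e, so that T x has no component in the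
      Peirce 1-space, that is, p (T x) = (T x) q ([T1_commute]).
    - {e, e, T (x x)} = {T x, e, T x} ([T1_square]).
    - D x D(x^☆)^☆ D x = 0, where D x = T x - p (T x) is the Peirce 0-component
      ([defect_cube]). The Peirce 2- and 0-spaces being orthogonal, D also
      respects the relation {a, b, c} = 1, except that it sends 1 to 0; the
      term of degree three in t is then the first one that survives. For
      self-adjoint x this gives z z^☆ z = 0 with z = D x, hence D x = 0 by the
      C*-identity, and D = 0 follows ([defect_eq0]).

    So T takes values in the Peirce 2-space, where {e, e, -} is the identity,
    and the first two equations say that T respects the involution and the
    squares: T is a Jordan *-homomorphism. As the triple product of a
    C*-algebra is a Jordan polynomial in a, b^☆, c ([anticommutator_triple]),
    T preserves it as well ([T_triple]). *)

Local Notation punctured0 R := ((0 : (R[i] : numFieldType)^o)^').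

(** * Algebra in a possibly non-unital C*-algebra *)

Section Algebra.
Context {R : realType} {A : cstarAlgType R}.
Implicit Types (a b c x y z : A) (k : R[i]).

Lemma cmul0l a : 0 ** a = 0.
Proof. by rewrite -(scale0r (0 : A)) cmulZl !scale0r. Qed.

Lemma cmul0r a : a ** 0 = 0.
Proof. by rewrite -(scale0r (0 : A)) cmulZr !scale0r. Qed.

Lemma cmulNl a b : (- a) ** b = - (a ** b).
Proof. by rewrite -scaleN1r cmulZl scaleN1r. Qed.

Lemma cmulNr a b : a ** (- b) = - (a ** b).
Proof. by rewrite -scaleN1r cmulZr scaleN1r. Qed.

Lemma cmulBl a b c : (a - b) ** c = a ** c - b ** c.
Proof. by rewrite cmulDl cmulNl. Qed.

Lemma cmulBr a b c : a ** (b - c) = a ** b - a ** c.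
Proof. by rewrite cmulDr cmulNr. Qed.

Lemma cstarN a : (- a)^☆ = - a^☆.
Proof. by rewrite -scaleN1r cstarZ rmorphN1 scaleN1r. Qed.

Lemma cstarB a b : (a - b)^☆ = a^☆ - b^☆.
Proof. by rewrite cstarD cstarN. Qed.

Lemma cstar_unit (u : A) : is_unit u -> u^☆ = u.
Proof.
by move=> [ul ur]; rewrite -[LHS]ur -{2}[u]cstarK -cstarM ur cstarK.
Qed.

(** The C*-identity gives |b|^2 <= |b^☆| |b|, and b can be replaced by b^☆. *)
Lemma cnorm_cstar a : `|a^☆| = `|a|.
Proof.
suff le b : `|b| <= `|b^☆|.
  by apply/eqP; rewrite eq_le (le a) -{2}[a]cstarK (le a^☆).
have [->|b0] := eqVneq b 0; first by rewrite normr0.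
have bp : 0 < `|b| by rewrite normr_gt0.
by rewrite -(ler_pM2r bp) -expr2 -cnorm_star cnormM.
Qed.

Lemma cmul_star_eq0 a : a^☆ ** a = 0 -> a = 0.
Proof.
by move=> a0; apply/eqP; rewrite -normr_eq0 -sqrf_eq0 -cnorm_star a0 normr0.
Qed.

(** With h = a^☆ a, the hypothesis gives h^☆ h = a^☆ (a a^☆ a) = 0, so the
    C*-identity applies twice. *)
Lemma cube_eq0 a : a ** a^☆ ** a = 0 -> a = 0.
Proof.
move=> a0; do 2 apply: cmul_star_eq0.
by rewrite cstarM cstarK -cmulA (cmulA a) a0 cmul0r.
Qed.

Lemma tprodC a b c : tprod a b c = tprod c b a.
Proof. by rewrite /tprod addrC. Qed.

Lemma tprodDl a a' b c : tprod (a + a') b c = tprod a b c + tprod a' b c.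
Proof. by rewrite /tprod !(cmulDl, cmulDr) addrACA scalerDr. Qed.

Lemma tprodDr a b c c' : tprod a b (c + c') = tprod a b c + tprod a b c'.
Proof. by rewrite tprodC tprodDl !(tprodC _ b a). Qed.

Lemma tprodDm a b b' c : tprod a (b + b') c = tprod a b c + tprod a b' c.
Proof. by rewrite /tprod cstarD !(cmulDl, cmulDr) addrACA scalerDr. Qed.

Lemma tprodZl k a b c : tprod (k *: a) b c = k *: tprod a b c.
Proof. by rewrite /tprod !(cmulZl, cmulZr) -scalerDr !scalerA mulrC. Qed.

Lemma tprodZr k a b c : tprod a b (k *: c) = k *: tprod a b c.
Proof. by rewrite tprodC tprodZl tprodC. Qed.

Lemma tprodZm k a b c : tprod a (k *: b) c = Num.conj k *: tprod a b c.
Proof.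
by rewrite /tprod cstarZ !(cmulZl, cmulZr) -scalerDr !scalerA mulrC.
Qed.

Lemma tprodNm a b c : tprod a (- b) c = - tprod a b c.
Proof. by rewrite -scaleN1r tprodZm rmorphN1 scaleN1r. Qed.

Lemma two_tprod a b c : 2%:R *: tprod a b c = a ** b^☆ ** c + c ** b^☆ ** a.
Proof. by rewrite /tprod scalerA divff ?scale1r // pnatr_eq0. Qed.

Lemma tprod_diag a b : tprod a b a = a ** b^☆ ** a.
Proof.
apply: (@scalerI _ A 2%:R); first by rewrite pnatr_eq0.
by rewrite two_tprod scaler_nat mulr2n.
Qed.

End Algebra.

(** * Continuity of the operations *)

Section Limits.
Context {R : realType} {A : cstarAlgType R}.

Section Filter.
Context {I : Type} {F : set_system I} {FF : Filter F}.

Lemma cvg_cmul (f g : I -> A) (a b : A) :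
  f @ F --> a -> g @ F --> b -> (fun i => f i ** g i) @ F --> a ** b.
Proof.
move=> fa gb; apply/cvgrPdist_lt => e e0.
have dp (r : A) : 0 < `|r| + 1 by rewrite ltr_wpDl.
have e20 : 0 < e / 2 by rewrite divr_gt0.
near=> i.
have -> : a ** b - f i ** g i = (a - f i) ** g i + a ** (b - g i).
  by rewrite cmulBl cmulBr [RHS]addrC subrKA.
have gi : `|g i| <= `|b| + 1.
  have -> : g i = b - (b - g i) by rewrite opprB addrC subrK.
  apply: (le_trans (ler_normB _ _)); rewrite lerD2l ltW //.
  by near: i; apply: (cvgr_dist_lt _ _ gb); rewrite ltr01.
rewrite (splitr e); apply: (le_lt_trans (ler_normD _ _)); apply: ltr_leD.
  apply: (le_lt_trans (cnormM _ _)).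
  apply: (le_lt_trans (ler_wpM2l (normr_ge0 _) gi)).
  rewrite -ltr_pdivlMr //.
  by near: i; apply: (cvgr_dist_lt _ _ fa); rewrite divr_gt0.
apply: (le_trans (cnormM _ _)).
apply: (@le_trans _ _ ((`|a| + 1) * `|b - g i|)).
  by rewrite ler_wpM2r // lerDl.
rewrite mulrC -ler_pdivlMr // ltW //.
by near: i; apply: (cvgr_dist_lt _ _ gb); rewrite divr_gt0.
Unshelve. all: by end_near. Qed.

Lemma cvg_cstar (f : I -> A) (a : A) :
  f @ F --> a -> (fun i => (f i)^☆) @ F --> a^☆.
Proof.
move=> fa; apply/cvgrPdist_lt => e e0.
near=> i; rewrite -cstarB cnorm_cstar.
by near: i; exact: (cvgr_dist_lt _ _ fa).
Unshelve. all: by end_near. Qed.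

Lemma cvg_tprod (f g h : I -> A) (a b c : A) :
  f @ F --> a -> g @ F --> b -> h @ F --> c ->
  (fun i => tprod (f i) (g i) (h i)) @ F --> tprod a b c.
Proof.
move=> fa /cvg_cstar gb hc; rewrite /tprod; apply: cvgZl_tmp.
by apply: cvgD; do 2 apply: cvg_cmul => //.
Qed.

End Filter.

Lemma limit_near_eq (f g : R[i] -> A) (a b : A) :
  f @ punctured0 R --> a -> g @ punctured0 R --> b ->
  (\forall t \near punctured0 R, f t = g t) -> a = b.
Proof.
move=> fa gb fg; apply: (cvg_unique (@norm_hausdorff _ A) fa).
apply: cvg_trans gb; apply: near_eq_cvg.
by apply: filterS fg => t ->.
Qed.

End Limits.

(** * Resolvents near the unit *)

Section Resolvent.
Context {R : realType}.

(** The order of R[i] is partial, but its nonnegative elements are real, so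
    that the archimedean property of R applies. *)
Lemma lt_geometric (C eps : R[i]) :
  0 <= C -> 0 < eps -> exists N, C < eps * 2 ^+ N.
Proof.
move=> C0 e0; have q0 : 0 <= C / eps by rewrite divr_ge0 // ltW.
have Eq : C / eps = (complex.Re (C / eps))%:C%C.
  by rewrite RRe_real // ger0_real.
exists (Num.truncn (complex.Re (C / eps))).+1.
rewrite mulrC -ltr_pdivrMr // Eq.
rewrite -(rmorph_nat (real_complex R)) -rmorphXn ltcR.
apply: (lt_le_trans (truncnS_gt _)); rewrite -natrX ler_nat.
exact/ltnW/ltn_expl.
Qed.

Context {A : cstarAlgType R} {one : A} (one_unit : is_unit one).

(** The Neumann series of (1 - x)^-1. Its partial sums are the iterates of
    y |-> 1 + x y at 1; each of them commutes with x, hence so does their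
    limit. *)
Lemma neumann (x : A) : `|x| <= 2^-1 ->
  exists y, y = one + x ** y /\ x ** y = y ** x.
Proof.
case: one_unit => ul ur xle.
pose s n := iter n (fun y => one + x ** y) one.
have sS n : s n.+1 = one + x ** s n by [].
have base k : `|s k - one| <= `|one|.
  elim: k => [|k IH]; first by rewrite subrr normr0.
  rewrite sS addrC addKr; apply: (le_trans (cnormM _ _)).
  have sk : `|s k| <= 2 * `|one|.
    rewrite -[s k](subrK one) mulr_natl mulr2n.
    exact: le_trans (ler_normD _ _) (lerD IH _).
  apply: (le_trans (ler_pM _ _ xle sk)) => //.
  by rewrite mulrA mulVf ?mul1r // pnatr_eq0.
have step n k : `|s (n + k)%N - s n| <= 2^-1 ^+ n * `|one|.
  elim: n => [|n IH]; first by rewrite expr0 mul1r; exact: base.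
  rewrite addSn !sS opprD addrACA subrr add0r -cmulBr exprS -mulrA.
  by apply: (le_trans (cnormM _ _)); rewrite ler_pM.
have cs : cauchy (s @ \oo).
  apply: cauchy_exP => e e0.
  have [N HN] := lt_geometric _ _ (normr_ge0 one) e0.
  exists (s N); exists N => // n /= Nn; rewrite -ball_normE /ball_ /=.
  rewrite distrC -(subnKC Nn); apply: (le_lt_trans (step _ _)).
  by rewrite exprVn mulrC ltr_pdivrMr ?exprn_gt0.
have /cvg_ex[y sy] : cvg (s @ \oo) by exact: cauchy_cvg.
have syS : (fun n => s n.+1) @ \oo --> y by rewrite cvg_shiftS.
have xs : (fun n => x ** s n) @ \oo --> x ** y.
  by apply: cvg_cmul => //; exact: cvg_cst.
exists y; split.
  apply: (cvg_unique (@norm_hausdorff _ A) syS).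
  by apply: cvgD => //; exact: cvg_cst.
apply: (cvg_unique (@norm_hausdorff _ A) xs).
have -> : (fun n => x ** s n) = (fun n => s n ** x).
  apply/funext; elim=> [|n IH]; first by rewrite /s /= ul ur.
  by rewrite !sS cmulDr cmulDl ul ur {1}IH cmulA.
by apply: cvg_cmul => //; exact: cvg_cst.
Qed.

(** Besides the inverse y t of 1 - t x, its first-order expansion
    y t = 1 + t x (y t) is kept as an exact equation: it lets identities be
    divided by t before the limit is taken, with no remainder to estimate. *)
Lemma resolvent (x : A) : exists y : R[i] -> A,
  [/\ y @ punctured0 R --> one, (fun t => x ** y t) @ punctured0 R --> x &
  \forall t \near punctured0 R,
    [/\ t != 0, y t = one + t *: (x ** y t),
        (one - t *: x) ** y t = one & y t ** (one - t *: x) = one]].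
Proof.
case: (one_unit) => ul ur.
have tx0 : t *: x @[t --> punctured0 R] --> (0 : A).
  by rewrite -(scale0r x); apply: cvgZr_tmp; exact: nbhs_dnbhs.
have small : \forall t \near punctured0 R, `|t *: x| <= 2^-1.
  by apply: (cvgr0_norm_le _ tx0); rewrite invr_gt0.
have ex t : exists y, `|t *: x| <= 2^-1 -> y = one + (t *: x) ** y /\
    (t *: x) ** y = y ** (t *: x).
  have [/neumann[y Hy]|_] := boolP (`|t *: x| <= 2^-1); first by exists y.
  by exists one.
have [y Hy] := choice ex; exists y.
have near_y : \forall t \near punctured0 R,
    [/\ t != 0, y t = one + t *: (x ** y t),
        (one - t *: x) ** y t = one & y t ** (one - t *: x) = one].
  near=> t.
  have t0 : t != 0 by near: t; exact: nbhs_dnbhs_neq.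
  have [|E1 E2] := Hy t; first by near: t.
  have wy : (one - t *: x) ** y t = one by rewrite cmulBl ul {1}E1 addrK.
  split=> //; first by rewrite -cmulZl.
  by rewrite -[RHS]wy cmulBl cmulBr ul ur E2.
suff y1 : y @ punctured0 R --> one.
  split=> //; rewrite -{2}[x]ur.
  by apply: cvg_cmul => //; exact: cvg_cst.
apply/cvgrPdist_lt => e e0.
near=> t.
have tx : `|t *: x| <= 2^-1 by near: t.
have Ey : y t = one + t *: (x ** y t).
  by near: t; apply: filterS near_y => t [].
(* From y = 1 + (t x) y and |t x| <= 1/2. *)
have yle : `|y t| <= 2 * `|one|.
  have : `|y t| <= `|one| + 2^-1 * `|y t|.
    rewrite {1}Ey; apply: (le_trans (ler_normD _ _)); rewrite lerD2l -cmulZl.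
    by apply: (le_trans (cnormM _ _)); rewrite ler_wpM2r.
  rewrite -lerBlDr {1}(splitr `|y t|) (mulrC 2^-1) addrK ler_pdivrMr //.
  by rewrite mulrC.
rewrite {1}Ey opprD addrA subrr sub0r normrN -cmulZl.
apply: (le_lt_trans (cnormM _ _)).
apply: (le_lt_trans (ler_wpM2l (normr_ge0 _) yle)).
apply: (@le_lt_trans _ _ (`|t *: x| * (2 * `|one| + 1))).
  by rewrite ler_wpM2l // lerDl.
have dp : 0 < 2 * `|one| + 1 by rewrite ltr_wpDl // mulr_ge0.
rewrite -ltr_pdivlMr //; near: t.
by apply: (cvgr0_norm_lt _ tx0); rewrite divr_gt0.
Unshelve. all: by end_near. Qed.

End Resolvent.

(** * Consequences of the hypothesis at the unit *)

(** These are the only solutions of {a, b, c} = 1, besides {1, 1, 1}, to which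
    the hypothesis on T is ever applied. *)
Lemma tprod_inverse {R : realType} {A : cstarAlgType R} (one w y : A) :
  is_unit one -> w ** y = one -> y ** w = one ->
  [/\ tprod one w^☆ y = one, tprod w one y = one &
      tprod y (w ** w)^☆ y = one].
Proof.
move=> ou wy yw; have [ul ur] := ou.
split; apply: (@scalerI _ A 2%:R); rewrite ?pnatr_eq0 // two_tprod
  ?cstarK ?(cstar_unit _ ou) ?ul ?ur ?wy ?yw; rewrite ?scaler_nat ?mulr2n //.
by rewrite !cmulA yw ul wy.
Qed.

(** The Jordan expression of abc + cba. It is stated for any associative
    biadditive m because it is used twice: for the product of A, and for
    (u, v) |-> u e^☆ v in B. *)
Lemma anticommutator_triple {V : zmodType} (m : V -> V -> V) (a b c : V) :
  associative m -> left_distributive m +%R -> right_distributive m +%R ->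
  let j x y := m x y + m y x in
  j (j a b) c + j a (j b c) = (m (m a b) c + m (m c b) a) *+ 2 + j b (j a c).
Proof.
move=> mA mDl mDr j; rewrite /j !(mDl, mDr) !mA mulr2n !addrA.
by rewrite [LHS](ACl (1*4*5*8*2*7*6*3)).
Qed.

Section UnitTriples.
Context {R : realType} {A B : cstarAlgType R} {one : A}.
Hypothesis one_unit : is_unit one.
Context {T : {linear A -> B}}.
Hypothesis T_cont : continuous T.
Hypothesis T_one : triple_hom_at T one.

Local Notation e := (T one).

Lemma cvg_T {I : Type} {F : set_system I} {FF : Filter F} (f : I -> A) (a : A) :
  f @ F --> a -> (fun i => T (f i)) @ F --> T a.
Proof. by move=> fa; exact: cvg_comp fa (T_cont a). Qed.

Lemma tripotent_T1 : tprod e e e = e.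
Proof.
apply: T_one; have [ul ur] := one_unit.
by rewrite tprod_diag (cstar_unit _ one_unit) !ul.
Qed.

(** Applying T to {1, w^☆, y} = 1 with w = 1 - t x leaves
    {e, e, T (x y)} = {e, T (x^☆), T y} after division by t. *)
Lemma T1_star_transfer (x : A) : tprod e e (T x) = tprod e (T x^☆) e.
Proof.
have [y [y1 xy1 Hy]] := resolvent one_unit x.
apply: (limit_near_eq (fun t => tprod e e (T (x ** y t)))
                      (fun t => tprod e (T x^☆) (T (y t)))).
- by apply: cvg_tprod; [exact: cvg_cst|exact: cvg_cst|exact: cvg_T].
- by apply: cvg_tprod; [exact: cvg_cst|exact: cvg_cst|exact: cvg_T].
apply: filterS Hy => t [t0 Ey wy yw].
have [/T_one + _ _] := tprod_inverse _ _ _ one_unit wy yw.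
rewrite cstarB cstarZ (cstar_unit _ one_unit) linearB linearZ /=.
rewrite tprodDm tprodNm tprodZm conjCK {1}Ey linearD linearZ /=.
rewrite tprodDr tprodZr tripotent_T1 -addrA => /(canRL (addKr _)).
rewrite addNr => /eqP; rewrite subr_eq0 => /eqP; exact: scalerI.
Qed.

(** Applying T to {w, 1, y} = 1 with w = 1 - t x gives
    {e, e, T (x y)} = {T x, e, T y} after division by t. Both sides are
    {e, e, T x} at t = 0, so expanding y once more allows a second division. *)
Lemma T1_square (x : A) : tprod e e (T (x ** x)) = tprod (T x) e (T x).
Proof.
have [ul ur] := one_unit.
have [y [y1 xy1 Hy]] := resolvent one_unit x.
apply: (limit_near_eq (fun t => tprod e e (T (x ** (x ** y t))))
                      (fun t => tprod (T x) e (T (x ** y t)))).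
- apply: cvg_tprod; [exact: cvg_cst|exact: cvg_cst|apply: cvg_T].
  by apply: cvg_cmul => //; exact: cvg_cst.
- by apply: cvg_tprod; [exact: cvg_cst|exact: cvg_cst|exact: cvg_T].
apply: filterS Hy => t [t0 Ey wy yw].
have [_ /T_one + _] := tprod_inverse _ _ _ one_unit wy yw.
rewrite linearB linearZ /= tprodDl -scaleN1r !tprodZl.
rewrite scaleN1r {1}Ey linearD linearZ /=.
rewrite tprodDr tprodZr tripotent_T1 -addrA => /(canRL (addKr _)).
rewrite addNr => /eqP; rewrite subr_eq0 => /eqP /(scalerI t0).
move=> E; apply/(scalerI t0)/(@addrI _ (tprod e e (T x))).
rewrite -!tprodZr -linearZ -!tprodDr -linearD.
rewrite [in RHS](tprodC e) -tprodDr -linearZ -linearD /= -Ey -E.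
by rewrite {2}Ey cmulDr cmulZr ur.
Qed.

Lemma T1_partial_isometry : e ** e^☆ ** e = e.
Proof. by rewrite -tprod_diag tripotent_T1. Qed.

(** With X = T x and M = e T(x^☆)^☆ e, [T1_star_transfer] reads
    p X + X q = 2 M, where p M = M = M q. Multiplying by p on the left gives
    p X q = X q, and by q on the right p X q = p X. *)
Lemma T1_commute (x : A) : e ** e^☆ ** T x = T x ** e^☆ ** e.
Proof.
have pe := T1_partial_isometry.
have := congr1 (fun z => 2%:R *: z) (T1_star_transfer x).
rewrite /= !two_tprod; set S := (T x^☆)^☆; set X := T x.
set M := e ** S ** e; set p := e ** e^☆.
have ep : e ** e^☆ ** e = e by [].
have EpM : p ** M = M by rewrite /M /p !cmulA ep.
have EMq : M ** e^☆ ** e = M by rewrite /M -!cmulA (cmulA e e^☆) ep.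
move=> E.
have L : p ** X ** e^☆ ** e = X ** e^☆ ** e.
  have := congr1 (fun z => p ** z) E; rewrite /= !cmulDr EpM -E !cmulA.
  by rewrite /p ep => /addrI.
have Rt : p ** X ** e^☆ ** e = p ** X.
  have := congr1 (fun z => z ** e^☆ ** e) E; rewrite /= !cmulDl EMq -E.
  have -> : X ** e^☆ ** e ** e^☆ ** e = X ** e^☆ ** e.
    by rewrite -!cmulA (cmulA e e^☆) ep.
  by move=> /addIr.
by rewrite -Rt L.
Qed.

(** Because p (T x) = (T x) q, this is the Peirce 0-component of T x, namely
    (1 - p) (T x) (1 - q), written without units. *)
Definition defect (x : A) : B := T x - e ** e^☆ ** T x.

Lemma defectD x y : defect (x + y) = defect x + defect y.
Proof. by rewrite /defect linearD cmulDr opprD addrACA. Qed.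

Lemma defectZ k x : defect (k *: x) = k *: defect x.
Proof. by rewrite /defect linearZ cmulZr scalerBr. Qed.

Lemma defect1 : defect one = 0.
Proof. by rewrite /defect T1_partial_isometry subrr. Qed.

Lemma cvg_defect {I : Type} {F : set_system I} {FF : Filter F} (f : I -> A)
    (a : A) : f @ F --> a -> (fun i => defect (f i)) @ F --> defect a.
Proof.
move=> fa; apply: cvgB; first exact: cvg_T.
by apply: cvg_cmul; [exact: cvg_cst|exact: cvg_T].
Qed.

(** Orthogonality of the Peirce 2- and 0-spaces: the mixed terms of the
    product vanish. *)
Lemma defect_product (a b c : A) :
  defect a ** (defect b)^☆ ** defect c =
  T a ** (T b)^☆ ** T c - e ** e^☆ ** (T a ** (T b)^☆ ** T c).
Proof.
have pe := T1_partial_isometry.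
rewrite /defect; set p := e ** e^☆; set u := T a; set w := T c.
have ps : p^☆ = p by rewrite cstarM cstarK.
have pp : p ** p = p by rewrite /p !cmulA pe.
set v := (T b)^☆.
have pu : p ** u = u ** e^☆ ** e := T1_commute a.
have pv : v ** p = e^☆ ** e ** v.
  have := congr1 cstar (T1_commute b).
  by rewrite !cstarM !cstarK -/p => ->; rewrite cmulA.
have upv : u ** v ** p = p ** u ** v by rewrite pu -!cmulA pv !cmulA.
clearbody p; have uvp0 : (u - p ** u) ** v ** p = 0.
  by rewrite !cmulBl -(cmulA p) -(cmulA p) upv !cmulA pp subrr.
rewrite cstarB cstarM ps -/v [_ ** (v - _)]cmulBr cmulA uvp0 subr0.
by rewrite cmulBr (cmulA _ p) uvp0 cmul0l subr0 !cmulBl !cmulA.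
Qed.

Lemma defect_triple (a b c : A) :
  tprod a b c = one -> tprod (defect a) (defect b) (defect c) = 0.
Proof.
move=> /T_one Te; apply: (@scalerI _ B 2%:R); first by rewrite pnatr_eq0.
rewrite two_tprod !defect_product addrACA -opprD -cmulDr -two_tprod Te.
by rewrite cmulZr T1_partial_isometry subrr scaler0.
Qed.

(** In {y, (w w)^☆, y} = 1 with w = 1 - t x, all three entries are 1 at t = 0,
    and [defect] sends 1 to 0; so each entry of the image is divisible by t. *)
Lemma defect_cube (x : A) : defect x ** (defect x^☆)^☆ ** defect x = 0.
Proof.
have [ul ur] := one_unit.
have [y [y1 xy1 Hy]] := resolvent one_unit x.
pose w (t : R[i]) := one - t *: x.
have w1 : w @ punctured0 R --> one.
  rewrite -[X in _ --> X]subr0 -(scale0r x); apply: cvgB; first exact: cvg_cst.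
  by apply: cvgZr_tmp; exact: nbhs_dnbhs.
(* w t ** w t = one - t *: v t *)
pose v t := x + x ** w t.
have v2 : v @ punctured0 R --> x + x.
  apply: cvgD; first exact: cvg_cst.
  by rewrite -{2}[x]ur; apply: cvg_cmul => //; exact: cvg_cst.
have : tprod (defect x) (defect (x + x)^☆) (defect x) = 0.
  apply: (limit_near_eq
    (fun t => tprod (defect (x ** y t)) (defect (v t)^☆) (defect (x ** y t)))
    (fun=> 0)); last 2 first.
  - exact: cvg_cst.
  - apply: filterS Hy => t [t0 Ey wy yw].
    have [_ _ /defect_triple] := tprod_inverse _ _ _ one_unit wy yw.
    have Dy : defect (y t) = t *: defect (x ** y t).
      by rewrite {1}Ey defectD defect1 add0r defectZ.
    have -> : (one - t *: x) ** (one - t *: x) = one + (- t) *: v t.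
      by rewrite {1}cmulBl ul cmulZl scaleNr scalerDr opprD addrA.
    rewrite cstarD cstarZ (cstar_unit _ one_unit) defectD defect1 add0r.
    rewrite defectZ Dy tprodZl tprodZm tprodZr conjCK => E.
    apply/(scalerI t0)/(@scalerI _ B (- t)); first by rewrite oppr_eq0.
    by apply: (scalerI t0); rewrite E !scaler0.
  by apply: cvg_tprod; [exact: (cvg_defect _ _ xy1)
    |exact: (cvg_defect _ _ (cvg_cstar _ _ v2))|exact: (cvg_defect _ _ xy1)].
rewrite cstarD defectD tprodDm tprod_diag => /eqP.
by rewrite -mulr2n -scaler_nat scaler_eq0 pnatr_eq0 => /eqP.
Qed.

Lemma defect_eq0 (x : A) : defect x = 0.
Proof.
have sa (h : A) : h^☆ = h -> defect h = 0.
  by move=> hs; apply: cube_eq0; rewrite -{2}hs; exact: defect_cube.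
(* Vanishing on x^☆ + x makes defect (x^☆) = - defect x. *)
have : defect (x^☆ + x) = 0 by apply: sa; rewrite cstarD cstarK addrC.
rewrite defectD => /eqP; rewrite addr_eq0 => /eqP sx.
apply: cube_eq0; have := defect_cube x.
by rewrite sx cstarN cmulNr cmulNl => /eqP; rewrite oppr_eq0 => /eqP.
Qed.

Lemma T_left (x : A) : e ** e^☆ ** T x = T x.
Proof. by apply/eqP; rewrite eq_sym -subr_eq0; apply/eqP/defect_eq0. Qed.

Lemma T_right (x : A) : T x ** e^☆ ** e = T x.
Proof. by rewrite -T1_commute T_left. Qed.

Lemma tprod_T1 (x : A) : tprod e e (T x) = T x.
Proof.
apply: (@scalerI _ B 2%:R); first by rewrite pnatr_eq0.
by rewrite two_tprod T_left T_right scaler_nat mulr2n.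
Qed.

Lemma T_star (x : A) : T x^☆ = e ** (T x)^☆ ** e.
Proof. by rewrite -tprod_T1 T1_star_transfer cstarK tprod_diag. Qed.

Lemma T_square (x : A) : T (x ** x) = T x ** e^☆ ** T x.
Proof. by rewrite -tprod_T1 T1_square tprod_diag. Qed.

Lemma T_anticommutator (a b : A) :
  T (a ** b + b ** a) = T a ** e^☆ ** T b + T b ** e^☆ ** T a.
Proof.
have := T_square (a + b).
rewrite (linearD T a b) !(cmulDl, cmulDr) !linearD /= !T_square.
by rewrite -!addrA => /addrI; rewrite !addrA => /addIr ->; rewrite addrC.
Qed.

(** The products u e^☆ v in the Jordan expression recombine into (T b)^☆ because
    T (b^☆) = e (T b)^☆ e and e^☆ e, e e^☆ act as units on the values of T. *)
Lemma T_triple (a b c : A) :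
  T (a ** b^☆ ** c + c ** b^☆ ** a) =
  T a ** (T b)^☆ ** T c + T c ** (T b)^☆ ** T a.
Proof.
have star_b u v : T u ** e^☆ ** T b^☆ ** e^☆ ** T v = T u ** (T b)^☆ ** T v.
  by rewrite T_star !cmulA T_right -!cmulA (cmulA e) T_left.
pose m u v := u ** e^☆ ** v.
have mA : associative m by move=> u v w; rewrite /m !cmulA.
have mDl : left_distributive m +%R by move=> u v w; rewrite /m !cmulDl.
have mDr : right_distributive m +%R by move=> u v w; rewrite /m cmulDr.
have /(congr1 T) := anticommutator_triple cmul a b^☆ c cmulA cmulDl cmulDr.
have := anticommutator_triple m (T a) (T b^☆) (T c) mA mDl mDr.
have T2 z : T (z *+ 2) = T z *+ 2 by rewrite !mulr2n linearD.
rewrite /= /m !star_b -!T_anticommutator -linearD /= => -> /esym.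
rewrite (linearD T (_ *+ 2)) T2 => /addIr E.
apply: (@scalerI _ B 2%:R); first by rewrite pnatr_eq0.
by rewrite !scaler_nat.
Qed.

End UnitTriples.

Theorem theorem3p4 (R : realType) (A B : cstarAlgType R) (one : A)
    (one_unit : is_unit one) (T : {linear A -> B}) (T_cont : continuous T)
    (T_one : triple_hom_at T one) :
  triple_hom T /\
  partial_isometry (T one) /\
  range T `<=` peirce2 (T one) /\
  jordan_star_hom_peirce2 (T one) T.
Proof.
split.
  by move=> a b c; rewrite /tprod linearZ (T_triple one_unit T_cont T_one).
split; first exact: (T1_partial_isometry one_unit T_one).
split.
  move=> _ [x _ <-]; exists (T x) => //.
  by rewrite (T_left one_unit T_cont T_one) (T_right one_unit T_cont T_one).
split=> [a b|a].
  rewrite /jprod /peirce2_jprod /tprod linearZ /=.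
  by rewrite (T_anticommutator one_unit T_cont T_one).
by rewrite (T_star one_unit T_cont T_one) /peirce2_star tprod_diag.
Qed.
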